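(* For every finite set $A$ of positive reals and every integer $\ell\ge0$, \[F^*_\ell(A;t)=\big(F^*_1(A;t)\big)^{\ell}\] as formal power series, where $F^*_\ell(A;t)=\sum_{n\ge0} r_\ell(\mathcal{C}^*_{n,A})\frac{t^n}{n!}$.
   Context: Let $A=\{a_1,\dots,a_m\}$ with $a_1>\dots>a_m>0$. For $n\ge1$, the semiorder-type arrangement $\mathcal{C}^*_{n,A}$ is the arrangement in $\mathbb{R}^n$ of hyperplanes $x_i-x_j=a_k$ ($i\ne j$, $1\le k\le m$). Regions are connected components of the complement of the union of the hyperplanes. The level of $X\subseteq\mathbb{R}^n$ is the smallest integer $\ell\ge0$ such that there are a linear subspace $W$ of dimension $\ell$ and $r>0$ with $X\subseteq\{\bm x:\min_{\bm y\in W}\|\bm x-\bm y\|\le r\}$. $r_\ell(\mathcal{A})$ is the number of regions of $\mathcal{A}$ of level $\ell$. Convention: for $n=0$ there is exactly one region, of level $0$.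
   Formalization: The finite set A is taken to be nonempty; for empty A the only region is the whole space, of level n, so the left side is t^ℓ/ℓ! while the right side is t^ℓ, and the identity fails for ℓ ≥ 2. *)

(* Defs.v *)
From HB Require Import structures.
From mathcomp Require Import all_boot all_order all_algebra.
From mathcomp Require Import all_classical all_reals all_analysis.
From mathcomp Require Import finmap.
Import numFieldTopology.Exports.
Unset Printing Implicit Defensive.
Import Order.TTheory GRing.Theory Num.Theory.
Local Open Scope classical_set_scope.
Local Open Scope ring_scope.


Definition eucl_dist {R : realType} {n : nat} (x y : 'rV[R]_n) : R :=
  Num.sqrt (\sum_(i < n) (x ord0 i - y ord0 i) ^+ 2).

Definition semiorder_complement {R : realType} (A : {fset R}) (n : nat) : set 'rV[R]_n :=
  [set x | forall (i j : 'I_n) (a : R), i != j -> a \in A ->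
             x ord0 i - x ord0 j != a].

Definition semiorder_regions {R : realType} (A : {fset R}) (n : nat) : set (set 'rV[R]_n) :=
  [set S | exists2 x, semiorder_complement A n x &
             S = connected_component (semiorder_complement A n) x].

(* X lies within bounded distance r > 0 of a linear subspace W of dimension l;
   W is the row space of a square matrix of rank l.  Since W is closed,
   min_{y in W} ||x - y|| <= r  iff  some y in W has ||x - y|| <= r. *)
Definition near_subspace_dim {R : realType} {n : nat} (X : set 'rV[R]_n) (l : nat) : Prop :=
  exists (W : 'M[R]_n) (r : R), \rank W = l /\ 0 < r /\
    forall x, X x -> exists2 y : 'rV[R]_n, (y <= W)%MS & eucl_dist x y <= r.

Definition has_level {R : realType} {n : nat} (X : set 'rV[R]_n) (l : nat) : Prop :=
  near_subspace_dim X l /\ forall k : nat, (k < l)%N -> ~ near_subspace_dim X k.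

Definition r_level {R : realType} (A : {fset R}) (l n : nat) : nat :=
  #|` fset_set [set S | semiorder_regions A n S /\ has_level S l] |.


Definition fps_mul {K : pzRingType} (f g : nat -> K) : nat -> K :=
  fun n => \sum_(i < n.+1) f i * g (n - i)%N.
Definition fps_one (K : pzRingType) : nat -> K := fun n => if n == 0%N then 1 else 0.
Definition fps_exp {K : pzRingType} (f : nat -> K) (l : nat) : nat -> K :=
  iter l (fps_mul f) (@fps_one K).

Definition F_star {R : realType} (A : {fset R}) (l : nat) : nat -> rat :=
  fun n => (r_level A l n)%:R / (n`!)%:R.

(* Main.v *)
Require Import Defs.
From HB Require Import structures.
From mathcomp Require Import all_boot all_order all_algebra.
From mathcomp Require Import all_classical all_reals all_analysis.
From mathcomp Require Import finmap.
From mathcomp Require Import ring lra.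
Import numFieldTopology.Exports.
Import Order.TTheory GRing.Theory Num.Theory.
Local Open Scope ring_scope.

(* Call U a cut of a point x if x_i - x_j exceeds every element of A whenever i
   is in U and j is not. The cuts of x form a chain from the empty set to the
   whole index set, and they depend only on the sign pattern of x, that is, on
   the region of x. Raising all the coordinates in a cut stays in the region, so
   the indicators of the nonempty cuts lie in every subspace near the region;
   conversely, between consecutive cuts the coordinates have no large gap, so
   the region lies within bounded distance of the span of these indicators.
   Hence the level of a region is its number of nonempty cuts. Splitting a
   region of level l + 1 along its smallest nonempty cut T yields a region of
   level 1 on the coordinates in T and one of level l on the others; shifting T
   far up inverts this, which is F_(l+1) = F_1 F_l. *)

(** * Patterns and cuts *)

Section Patterns.
Import mathcomp.boot.fintype mathcomp.boot.finset.
Local Set Implicit Arguments.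
Local Unset Strict Implicit.
Context {R : realType} {A : {fset R}}.

(** Indices run over a subset [S] of a fixed type, so that a point and its parts on a cut and on the
    complement are all given by one function [x]. *)
Definition generic {I : finType} (S : {set I}) (x : I -> R) :=
  forall i j (a : A), i \in S -> j \in S -> x i - x j != val a.

(** The sign vector of [x] with respect to the hyperplanes. *)
Definition pattern {I : finType} (S : {set I}) (x : I -> R) : {set I * I * A} :=
  [set t | [&& t.1.1 \in S, t.1.2 \in S & x t.1.1 - x t.1.2 < val t.2]].

(* Stated on patterns: (i, j, a) is not in p when x_i - x_j >= a, and equality
   is excluded for generic points. *)
Definition cuts {I : finType} (S : {set I}) (p : {set I * I * A}) : {set {set I}} :=
  [set U : {set I} | (U \subset S) &&
           [forall i in U, forall j in S :\: U, forall a : A, (i, j, a) \notin p]].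

(** The count is [l.+1] because the empty cut is always present: level [l] means [l] nonempty
    cuts. *)
Definition patterns {I : finType} (S : {set I}) (l : nat) : {set {set I * I * A}} :=
  [set p | `[< exists x, [/\ generic S x, p = pattern S x & #|cuts S p| = l.+1] >]].

Lemma in_pattern (I : finType) (S : {set I}) x i j a :
  (i, j, a) \in pattern S x = [&& i \in S, j \in S & x i - x j < val a].
Proof. by rewrite inE. Qed.

Lemma cutsP (I : finType) (S U : {set I}) x :
  reflect (U \subset S /\ forall i j (a : A), i \in U -> j \in S -> j \notin U ->
             val a <= x i - x j)
          (U \in cuts S (pattern S x)).
Proof.
rewrite inE; apply: (iffP andP) => -[US H]; split => //.
  move=> i j a iU jS jU; move/forall_inP: H => /(_ i iU)/forall_inP/(_ j).
  rewrite inE jU jS => /(_ isT)/forallP/(_ a).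
  by rewrite in_pattern jS (subsetP US _ iU) /= -leNgt.
apply/forall_inP => i iU; apply/forall_inP => j; rewrite inE => /andP[jU jS].
by apply/forallP => a; rewrite in_pattern jS (subsetP US _ iU) /= -leNgt; exact: H.
Qed.

Lemma patternsP (I : finType) (S : {set I}) l p :
  reflect (exists x, [/\ generic S x, p = pattern S x & #|cuts S p| = l.+1])
          (p \in patterns S l).
Proof. by rewrite inE; exact: asboolP. Qed.

Lemma finite_upper_bound (J : finType) (f : J -> R) : exists c, forall j, f j < c.
Proof.
exists (1 + \sum_j `|f j|) => j; rewrite (bigD1 j) //=.
have := ler_norm (f j); have : 0 <= \sum_(i | i != j) `|f i| by apply: sumr_ge0.
by move=> *; lra.
Qed.

Lemma cuts0 (I : finType) (S : {set I}) x : set0 \in cuts S (pattern S x).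
Proof. by apply/cutsP; split; [exact: sub0set|move=> i j a; rewrite inE]. Qed.

Lemma cutsT (I : finType) (S : {set I}) x : S \in cuts S (pattern S x).
Proof. by apply/cutsP; split=> // i j a _ ->. Qed.

Lemma card_cuts_gt0 (I : finType) (S : {set I}) x : (0 < #|cuts S (pattern S x)|)%N.
Proof. by apply/card_gt0P; exists set0; exact: cuts0. Qed.

Lemma card_cuts_set0 (I : finType) (x : I -> R) :
  #|cuts set0 (pattern set0 x)| = 1%N.
Proof.
apply/eqP; rewrite eqn_leq card_cuts_gt0 andbT -(cards1 (set0 : {set I})).
apply/subset_leq_card/subsetP => U /cutsP[].
by rewrite subset0 inE.
Qed.

Lemma card_cuts1 (I : finType) (S : {set I}) x :
  #|cuts S (pattern S x)| = 1%N -> S = set0.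
Proof.
move=> /eqP/cards1P[U def].
have := cuts0 S x; have := cutsT S x.
by rewrite def !inE => /eqP-> /eqP->.
Qed.

Lemma cuts_card2 (I : finType) (S : {set I}) x :
  #|cuts S (pattern S x)| = 2%N ->
  S != set0 /\ cuts S (pattern S x) = [set set0; S].
Proof.
move=> c2; have S0 : S != set0.
  by apply/eqP => S0; move: c2; rewrite S0 card_cuts_set0.
split=> //; apply/esym/eqP; rewrite eqEcard c2 cards2 eq_sym S0 andbT.
by apply/subsetP => U; rewrite in_set2 => /orP[]/eqP->; [exact: cuts0|exact: cutsT].
Qed.

(** * Restriction to a subset of the indices *)

Definition restrict {I : finType} (S : {set I}) (p : {set I * I * A}) :=
  [set t in p | (t.1.1 \in S) && (t.1.2 \in S)].

Lemma restrict_pattern (I : finType) (S : {set I}) x :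
  restrict S (pattern setT x) = pattern S x.
Proof. by apply/setP => -[[i j] a]; rewrite !inE /= andbC andbA. Qed.

Lemma eq_pattern (I : finType) (S : {set I}) x y :
  {in S &, forall i j, x i - x j = y i - y j} -> pattern S x = pattern S y.
Proof.
move=> xy; apply/setP => -[[i j] a]; rewrite !in_pattern.
by case: (boolP (i \in S)) => // iS; case: (boolP (j \in S)) => //= jS; rewrite xy.
Qed.

Lemma cutsI (I : finType) (S V : {set I}) x :
  V \in cuts setT (pattern setT x) -> V :&: S \in cuts S (pattern S x).
Proof.
move=> /cutsP[_ cV]; apply/cutsP; split; first exact: subsetIr.
move=> i j a; rewrite !inE => /andP[iV iS] jS; rewrite jS andbT => jV.
by apply: cV; rewrite ?inE.
Qed.

Lemma cuts_lower (I : finType) (T U : {set I}) x :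
  T \in cuts setT (pattern setT x) -> U \in cuts T (pattern T x) ->
  U \in cuts setT (pattern setT x).
Proof.
move=> /cutsP[_ cT] /cutsP[UT cU]; apply/cutsP; split; first exact: finset.subsetT.
move=> i j a iU _ jU; have iT := subsetP UT _ iU.
by case: (boolP (j \in T)) => jT; [exact: cU|apply: cT; rewrite ?inE].
Qed.

Lemma cuts_upper (I : finType) (T U : {set I}) x :
  T \in cuts setT (pattern setT x) -> U \in cuts (~: T) (pattern (~: T) x) ->
  T :|: U \in cuts setT (pattern setT x).
Proof.
move=> /cutsP[_ cT] /cutsP[UT cU]; apply/cutsP; split; first exact: finset.subsetT.
move=> i j a; rewrite !inE negb_or => /orP[iT|iU] _ /andP[jT jU].
  by apply: cT; rewrite ?inE.
by apply: cU; rewrite ?inE.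
Qed.

(** * The chain of cuts *)

Context (A_gt0 : forall a : A, 0 < val a) (a0 : A).

(** With i in [U] only and j in [V] only, both x_i - x_j and x_j - x_i would be at least [a0] >
    0. *)
Lemma cuts_chain (I : finType) (S U V : {set I}) x :
  U \in cuts S (pattern S x) -> V \in cuts S (pattern S x) ->
  (U \subset V) || (V \subset U).
Proof.
move=> /cutsP[US cU] /cutsP[VS cV]; apply: contraT.
rewrite negb_or => /andP[/subsetPn[i iU iV] /subsetPn[j jV jU]].
have := cU i j a0 iU (subsetP VS _ jV) jU; have := cV j i a0 jV (subsetP US _ iU) iV.
by have := A_gt0 a0; move=> *; lra.
Qed.

(** Every cut is comparable with [T]. Those inside [T] are the cuts of [T]; those containing [T]
    arise from cuts of the complement by adding [T]. The cut [T] itself is counted twice, whence the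
    successor. *)
Lemma card_cuts_split (I : finType) (T : {set I}) x :
  T \in cuts setT (pattern setT x) ->
  (#|cuts setT (pattern setT x)|.+1 =
   #|cuts T (pattern T x)| + #|cuts (~: T) (pattern (~: T) x)|)%N.
Proof.
move=> cT.
have inj : {in cuts (~: T) (pattern (~: T) x) &, injective (fun U : {set I} => T :|: U)}.
  move=> U V /cutsP[UT _] /cutsP[VT _] /setP eqUV; apply/setP => i.
  have := eqUV i; rewrite !inE; case: (boolP (i \in T)) => //= iT _.
  by apply/idP/idP => [/(subsetP UT)|/(subsetP VT)]; rewrite inE iT.
rewrite -(card_in_imset inj) -cardsUI.
set X := cuts T _; set Y := imset _ _.
have -> : X :&: Y = [set T].
  apply/setP => U; rewrite in_setI in_set1; apply/andP/eqP => [[]|->].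
    move=> UX /imsetP[V _ def]; apply/eqP; rewrite eqEsubset {2}def subsetUl andbT.
    by case/cutsP: UX.
  split; first exact: cutsT.
  by apply/imsetP; exists set0; [exact: cuts0|rewrite finset.setU0].
rewrite cards1 addn1; congr _.+1; apply/eq_card => V.
rewrite [RHS]inE; apply/idP/orP => [cV|[cV|/imsetP[U cU ->]]].
- case/orP: (cuts_chain cT cV) => sub; [right|left].
    apply/imsetP; exists (V :&: ~: T); first exact: cutsI.
    by apply/setP => i; rewrite !inE; have := subsetP sub i;
       case: (i \in T) => [->|]; rewrite ?andbT.
  by have := @cutsI _ T _ _ cV; rewrite (setIidPl sub).
- exact: cuts_lower cV.
- exact: cuts_upper.
Qed.

(** * The smallest nonempty cut and the splitting along it *)

Definition min_cut {I : finType} (p : {set I * I * A}) : {set I} :=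
  \bigcap_(U in cuts setT p | U != set0) U.

(** In a chain, a nonempty cut of least cardinality lies in all the other nonempty ones, so the
    intersection equals it. *)
Lemma min_cutP (I : finType) (x : I -> R) l :
  #|cuts setT (pattern setT x)| = l.+2 ->
  min_cut (pattern setT x) != set0 /\
  min_cut (pattern setT x) \in cuts setT (pattern setT x).
Proof.
move=> cc.
have TT : [set: I] \in cuts setT (pattern setT x) by exact: cutsT.
have T0 : [set: I] != set0.
  by apply/eqP => T0; move: cc; rewrite T0 card_cuts_set0.
have PT : (setT \in cuts setT (pattern setT x)) && ([set: I] != set0) by rewrite TT.
case: (@arg_minnP _ [set: I] (fun U : {set I} => (U \in cuts setT (pattern setT x)) && (U != set0))
   (fun U : {set I} => #|U|) PT) => U /andP[cU U0] Umin.
suff -> : min_cut (pattern setT x) = U by [].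
apply/eqP; rewrite eqEsubset bigcap_inf ?cU //=.
apply/bigcapsP => V /andP[cV V0].
case/orP: (cuts_chain cU cV) => // sub.
have := Umin V; rewrite cV V0 => /(_ isT) le.
by have /eqP -> : V == U by rewrite eqEcard sub.
Qed.

Lemma min_cut_sub (I : finType) (x : I -> R) (U : {set I}) :
  U \in cuts setT (pattern setT x) -> U != set0 -> min_cut (pattern setT x) \subset U.
Proof. by move=> cU U0; apply: bigcap_inf; rewrite cU. Qed.

(** Together with [cuts_min_cut]: a nonempty cut [T] is the smallest one exactly when the pattern on
    [T] has level 1. *)
Lemma min_cut_eq (I : finType) (x : I -> R) (T : {set I}) : T != set0 ->
  T \in cuts setT (pattern setT x) -> cuts T (pattern T x) = [set set0; T] ->
  min_cut (pattern setT x) = T.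
Proof.
move=> T0 cT c2; apply/eqP; rewrite eqEsubset min_cut_sub //=.
apply/bigcapsP => V /andP[cV V0].
case/orP: (cuts_chain cT cV) => // sub.
have := @cutsI _ T _ _ cV; rewrite (setIidPl sub) c2 !inE (negPf V0).
by move/eqP->.
Qed.

Lemma cuts_min_cut (I : finType) (x : I -> R) (T : {set I}) : T != set0 ->
  T \in cuts setT (pattern setT x) -> min_cut (pattern setT x) = T ->
  cuts T (pattern T x) = [set set0; T].
Proof.
move=> T0 cT mT; apply/setP => U; rewrite in_set2; apply/idP/idP; last first.
  by move=> /orP[]/eqP->; [exact: cuts0|exact: cutsT].
move=> cU.
have [//|U0] := eqVneq U set0; rewrite eqEsubset -{2}mT.
rewrite min_cut_sub //; last exact: cuts_lower cU.
by case/cutsP: cU => ->.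
Qed.

(** Comparisons across a cut are forced: from [T] to its complement a difference is at least every
    a, and in the other direction it is negative, so below every a. *)
Lemma restrict_inj (I : finType) (T : {set I}) x y :
  T \in cuts setT (pattern setT x) -> T \in cuts setT (pattern setT y) ->
  pattern T x = pattern T y -> pattern (~: T) x = pattern (~: T) y ->
  pattern setT x = pattern setT y.
Proof.
move=> /cutsP[_ cx] /cutsP[_ cy] /setP eT /setP eC.
apply/setP => -[[i j] a]; rewrite !in_pattern !in_setT /=.
have := eT (i, j, a); have := eC (i, j, a); rewrite !in_pattern !in_setC.
case: (boolP (i \in T)) => iT; case: (boolP (j \in T)) => jT //= _ _.
  have := cx i j a iT (in_setT _) jT; have := cy i j a iT (in_setT _) jT.
  by rewrite !leNgt => /negPf -> /negPf ->.
have := cx j i a0 jT (in_setT _) iT; have := cy j i a0 jT (in_setT _) iT.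
have := A_gt0 a0; have := A_gt0 a => H H0 H1 H2.
have -> : x i - x j < val a by lra.
by have -> : y i - y j < val a by lra.
Qed.

(** The pair of restrictions is a bijection: [restrict_inj] gives injectivity, and gluing two points
    gives surjectivity. *)
Lemma card_patterns_min_cut (I : finType) (T : {set I}) l :
  #|[set p in patterns setT l.+1 | min_cut p == T]| =
  (#|patterns T 1| * #|patterns (~: T) l|)%N.
Proof.
rewrite -cardsX.
pose h (p : {set I * I * A}) := (restrict T p, restrict (~: T) p).
have memP p : reflect (exists x, [/\ generic setT x, p = pattern setT x, T != set0,
    T \in cuts setT p & [/\ min_cut p = T, #|cuts setT p| = l.+2
    & cuts T (pattern T x) = [set set0; T]]])
   (p \in [set p in patterns setT l.+1 | min_cut p == T]).
  rewrite [p \in _]in_set; apply: (iffP andP) => [[/patternsP[x [gx -> cx]] /eqP mT]|].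
    exists x; have := @min_cutP _ _ _ cx; rewrite mT => -[T0 cT].
    by split=> //; split => //; exact: cuts_min_cut.
  move=> [x [gx -> T0 cT [mT cx cT2]]]; split; last exact/eqP.
  by apply/patternsP; exists x.
have inj : {in [set p in patterns setT l.+1 | min_cut p == T] &, injective h}.
  move=> _ _ /memP[x [_ -> _ cx _]] /memP[y [_ -> _ cy _]] [].
  by rewrite !restrict_pattern; exact: restrict_inj.
rewrite -(card_in_imset inj); apply/eq_card => -[p q].
rewrite inE /=; apply/imsetP/andP => [[_ /memP[x [gx -> T0 cT [mT cx c2]]] [-> ->]]|].
  rewrite !restrict_pattern; have := card_cuts_split cT.
  rewrite cx c2 cards2 eq_sym T0 => e.
  split; apply/patternsP; exists x; split=> //.
  - by move=> i j a _ _; apply: gx; rewrite inE.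
  - by rewrite c2 cards2 eq_sym T0.
  - by move=> i j a _ _; apply: gx; rewrite inE.
  - by move: e => /= [].
move=> [/patternsP[x [gx -> cx]] /patternsP[y [gy -> cy]]].
(* Since [c] exceeds a + y_j - x_i for all i, j, a, raising [x] by [c] on [T] puts it more than
   every a above all values of [y]. *)
have [c Hc] := @finite_upper_bound (I * I * A)%type
   (fun t => val t.2 + y t.1.2 - x t.1.1).
pose z i := if i \in T then x i + c else y i.
have pT : pattern T z = pattern T x.
  by apply: eq_pattern => i j iT jT; rewrite /z iT jT; lra.
have pC : pattern (~: T) z = pattern (~: T) y.
  by apply: eq_pattern => i j; rewrite !inE /z => /negPf -> /negPf ->.
have gz : generic setT z.
  move=> i j a _ _; rewrite /z.
  case: (boolP (i \in T)) => iT; case: (boolP (j \in T)) => jT.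
  - by rewrite (_ : _ - _ = x i - x j); [exact: gx|lra].
  - have := Hc (i, j, a) => /= lt; rewrite gt_eqF //; lra.
  - have := Hc (j, i, a) => /= lt; have := A_gt0 a => /= ?; rewrite lt_eqF //; lra.
  - by apply: gy; rewrite inE.
have cT : T \in cuts setT (pattern setT z).
  apply/cutsP; split; first exact: finset.subsetT.
  move=> i j a iT _ jT; rewrite /z iT (negPf jT).
  by have := Hc (i, j, a) => /= lt; lra.
have [T0 c2] := cuts_card2 cx.
exists (pattern setT z); last by rewrite /h !restrict_pattern pT pC.
apply/memP; exists z; split=> //; split; rewrite ?pT //.
  by apply: min_cut_eq; rewrite ?pT.
have := card_cuts_split cT; rewrite pT pC cx cy => -[].
by [].
Qed.

Lemma card_patternsS (I : finType) l :
  #|patterns [set: I] l.+1| =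
  (\sum_(T : {set I}) #|patterns T 1| * #|patterns (~: T) l|)%N.
Proof.
rewrite -sum1_card (partition_big min_cut predT) //=.
apply: eq_bigr => T _; rewrite -card_patterns_min_cut -sum1_card.
by apply: eq_bigl => p; rewrite [in RHS]inE.
Qed.

(** * Counting patterns by the size of the index set *)

Lemma card_patterns_imset (I J : finType) (f : J -> I) l : injective f ->
  #|patterns (f @: setT) l| = #|patterns [set: J] l|.
Proof.
move=> injf.
pose h (p : {set J * J * A}) : {set I * I * A} :=
  [set (f t.1.1, f t.1.2, t.2) | t in p].
have injh : injective h.
  apply: imset_inj => -[[i j] a] [[i' j'] a'] e.
  have /injf /= -> := congr1 (fun t => t.1.1) e.
  have /injf /= -> := congr1 (fun t => t.1.2) e.
  by have /= -> := congr1 snd e.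
have hE x : h (pattern setT (x \o f)) = pattern (f @: setT) x.
  apply/setP => -[[i j] a]; rewrite in_pattern; apply/imsetP/and3P.
    case=> -[[i' j'] a']; rewrite in_pattern !inE /= => lt [-> -> ->].
    by split=> //; exact/imset_f/in_setT.
  case=> /imsetP[i' _ ->] /imsetP[j' _ ->] lt.
  by exists (i', j', a) => //; rewrite in_pattern !inE.
have gE x : generic (f @: setT) x <-> generic setT (x \o f).
  split=> gx i j a; first by move=> _ _; apply: gx; exact/imset_f/in_setT.
  by move=> /imsetP[i' _ ->] /imsetP[j' _ ->]; apply: gx; rewrite inE.
have cE x : #|cuts (f @: setT) (pattern (f @: setT) x)| =
            #|cuts setT (pattern setT (x \o f))|.
  rewrite -(card_imset _ (imset_inj injf)); apply: eq_card => U.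
  apply/cutsP/imsetP => [[UT cU]|[V /cutsP[_ cV] ->]].
    exists (f @^-1: U); last first.
      apply/setP => i; apply/idP/imsetP => [iU|[j]]; last by rewrite inE => ? ->.
      have /imsetP[j _ e] := subsetP UT _ iU.
      by exists j => //; rewrite inE -e.
    apply/cutsP; split; first exact: finset.subsetT.
    by move=> i j a; rewrite !inE => iU _ jU; apply: cU => //; exact/imset_f/in_setT.
  split; first by apply/imsetS/finset.subsetT.
  move=> _ _ a /imsetP[i iV ->] /imsetP[j _ ->] jV.
  by apply: cV; rewrite ?inE //; apply: contra jV => jV; exact: imset_f.
rewrite -(card_imset _ injh); apply: eq_card => p; apply/patternsP/imsetP.
  case=> x [gx -> cx]; exists (pattern setT (x \o f)); last by rewrite hE.
  by apply/patternsP; exists (x \o f); rewrite -cE; split=> //; apply/gE.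
case=> _ /patternsP[y [gy -> cy]] ->.
(* Carry [y] over to the image of [f]; the value 0 is taken only outside the image, where the
   pattern on [f @: setT] does not look. *)
pose x i := if [pick j | f j == i] is Some j then y j else 0.
have xf : x \o f = y.
  apply/funext => j; rewrite /x /=; case: pickP => [k /eqP/injf -> //|/(_ j)].
  by rewrite eqxx.
by exists x; have := hE x; have := cE x; rewrite xf => cx ->; rewrite cx; split=> //;
  apply/gE; rewrite xf.
Qed.

Definition pattern_count (l n : nat) : nat := #|patterns [set: 'I_n] l|.

Lemma card_patternsE (I : finType) (T : {set I}) l :
  #|patterns T l| = pattern_count l #|T|.
Proof.
rewrite /pattern_count -(@card_patterns_imset _ _ (@enum_val _ (mem T)))//; last first.
  exact: enum_val_inj.
congr #|patterns _ _|; apply/setP => i; apply/idP/imsetP => [iT|[j _ ->]].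
  by exists (enum_rank_in iT i); rewrite ?inE // enum_rankK_in.
exact: enum_valP.
Qed.

(** The smallest cuts [T] are grouped by size k: there are 'C(n, k) of each size, and the
    contribution of [T] depends on k only. *)
Lemma pattern_countS l n :
  pattern_count l.+1 n =
  (\sum_(k < n.+1) 'C(n, k) * (pattern_count 1 k * pattern_count l (n - k)))%N.
Proof.
rewrite {1}/pattern_count card_patternsS.
rewrite (partition_big (fun T : {set 'I_n} => inord #|T| : 'I_n.+1) predT) //=.
apply: eq_bigr => k _.
rewrite (eq_bigr (fun=> pattern_count 1 k * pattern_count l (n - k)))%N; last first.
  move=> T /eqP e; have Tk : #|T| = k.
    by rewrite -e inordK // ltnS -[X in (_ <= X)%N]card_ord max_card.
  by rewrite !card_patternsE Tk cardsCs setCK Tk card_ord.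
rewrite big_const iter_addn_0 mulnC; congr muln.
rewrite -[n in 'C(n, _)]card_ord -card_draws cardsE; apply: eq_card => T.
rewrite !unfold_in /= inordK //.
by rewrite ltnS -[X in (_ <= X)%N]card_ord max_card.
Qed.

(** A single cut means that the empty set and the whole index set coincide. *)
Lemma pattern_count0 n : pattern_count 0 n = (n == 0)%N.
Proof.
rewrite /pattern_count; case: n => [|n].
  have T0 : [set: 'I_0] = set0 by apply/setP => -[].
  apply/eqP/cards1P; exists set0; apply/setP => p; rewrite in_set1.
  have e0 : pattern [set: 'I_0] (fun=> 0) = set0 by apply/setP => -[[[]]].
  apply/patternsP/eqP => [_|->]; first by apply/setP => -[[[]]].
  exists (fun=> 0); rewrite e0; split=> //; first by case.
  by rewrite -[X in cuts _ X]e0 T0 card_cuts_set0.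
apply/eqP; rewrite cards_eq0; apply/eqP/setP => p; rewrite in_set0.
apply/patternsP => -[x [_ -> /card_cuts1 /setP/(_ ord0)]].
by rewrite !inE.
Qed.


(** * Regions as sets of generic points with a common pattern *)

Definition region {n : nat} (p : {set 'I_n * 'I_n * A}) : set 'rV[R]_n :=
  [set y : 'rV[R]_n | generic setT (y ord0) /\ pattern setT (y ord0) = p]%classic.

Lemma semiorder_complementE n (x : 'rV[R]_n) :
  semiorder_complement A n x <-> generic setT (x ord0).
Proof.
split=> gx i j a; last by move=> _ aA; exact: (gx i j [` aA]%fset (in_setT _) (in_setT _)).
move=> _ _; have [->|ij] := eqVneq i j; last by apply: gx ij _; exact: fsvalP.
(* For i = j the condition reads 0 != a, true by positivity. *)
by rewrite subrr lt_eqF.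
Qed.

(** On the segment from [x] to [y], each coordinate difference is a convex combination of two
    numbers on the same side of a, so the segment avoids all the hyperplanes. *)
Lemma region_sub_component n (x : 'rV[R]_n) : generic setT (x ord0) ->
  (region (pattern setT (x ord0)) `<=`
   connected_component (semiorder_complement A n) x)%classic.
Proof.
move=> gx y [gy pxy].
pose f (t : R) : 'rV[R]_n := x + t *: (y - x).
have fE t i j : f t ord0 i - f t ord0 j =
    (1 - t) * (x ord0 i - x ord0 j) + t * (y ord0 i - y ord0 j).
  by rewrite /f !mxE; ring.
have cf : continuous f.
  move=> t; apply: cvgD; first exact: cvg_cst.
  exact: scalel_continuous.
have := @connected_component_max _ (semiorder_complement A n) (f @` `[0, 1]) x.
apply; first by exists 0; rewrite /= ?in_itv /= ?lexx ?ler01 // /f scale0r addr0.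
- move=> _ [t t01 <-]; apply/semiorder_complementE => i j a _ _.
  move: t01; rewrite /= in_itv /= => /andP[t0 t1].
  rewrite fE.
  have := gx i j a (in_setT _) (in_setT _); have := gy i j a (in_setT _) (in_setT _).
  have /setP/(_ (i, j, a)) := pxy; rewrite !in_pattern !in_setT /=.
  move: (x ord0 i - x ord0 j) (y ord0 i - y ord0 j) => u v.
  case: (ltgtP v (fsval a)) => // hv; case: (ltgtP u (fsval a)) => // hu _ _ _.
    by rewrite lt_eqF //; case: (leP u v) => ?; nra.
  by rewrite gt_eqF //; case: (leP u v) => ?; nra.
- apply: connected_continuous_connected; first exact: segment_connected.
  exact: continuous_subspaceT.
- by exists 1; rewrite /= ?in_itv /= ?lexx ?ler01 // /f scale1r addrC subrK.
Qed.

(** A coordinate difference is continuous, so it maps the component onto an interval; this interval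
    misses a and hence stays on one side of it. *)
Lemma component_sub_region n (x : 'rV[R]_n) : generic setT (x ord0) ->
  (connected_component (semiorder_complement A n) x `<=`
   region (pattern setT (x ord0)))%classic.
Proof.
move=> gx y Cy; have sub := @connected_component_sub _ (semiorder_complement A n) x.
have gy : generic setT (y ord0) by exact/semiorder_complementE/sub.
split=> //; apply/setP => -[[i j] a]; rewrite !in_pattern !in_setT /=.
pose g (z : 'rV[R]_n) : R := z ord0 i - z ord0 j.
have cg : continuous g.
  have ck k : continuous (fun z : 'rV[R]_n => z ord0 k) by exact: coord_continuous.
  by move=> z; exact: cvgB (ck i z) (ck j z).
have : is_interval (g @` connected_component (semiorder_complement A n) x).
  apply/connected_intervalP/connected_continuous_connected; first exact: component_connected.
  exact: continuous_subspaceT.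
have Cx : connected_component (semiorder_complement A n) x x.
  by apply: connected_component_refl; apply/semiorder_complementE.
have no u v : connected_component (semiorder_complement A n) x u ->
   connected_component (semiorder_complement A n) x v ->
   is_interval (g @` connected_component (semiorder_complement A n) x) ->
   g u < val a -> g v < val a.
  move=> Cu Cv itv uv; rewrite ltNge; apply/negP => av.
  have [w Cw gw] : (g @` connected_component (semiorder_complement A n) x)%classic (val a).
    by apply: itv (g u) (g v) _ _ _ _; [exists u|exists v|rewrite (ltW uv)].
  move/sub/semiorder_complementE: Cw => /(_ i j a (in_setT _) (in_setT _)).
  by rewrite -[X in X != _]/(g w) gw eqxx.
by move=> itv; apply/idP/idP; exact: no.
Qed.

Lemma component_region n (x : 'rV[R]_n) : generic setT (x ord0) ->
  connected_component (semiorder_complement A n) x = region (pattern setT (x ord0)).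
Proof.
move=> gx; apply/seteqP; split; [exact: component_sub_region|exact: region_sub_component].
Qed.

(** * The level of a region *)

Definition cut_indicator {n : nat} (U : {set 'I_n}) : 'rV[R]_n :=
  \row_i (i \in U)%:R.

(** The empty cut is left out because its zero row would spoil independence. *)
Definition cut_matrix {n : nat} (p : {set 'I_n * 'I_n * A}) :
    'M[R]_(#|cuts setT p :\ set0|, n) :=
  \matrix_k cut_indicator (enum_val k).

Lemma cut_indicator_sub n (p : {set 'I_n * 'I_n * A}) U : U \in cuts setT p ->
  (cut_indicator U <= cut_matrix p)%MS.
Proof.
move=> cU; have [->|U0] := eqVneq U set0.
  rewrite (_ : cut_indicator _ = 0) ?sub0mx //.
  by apply/rowP => i; rewrite !mxE inE.
have U1 : U \in cuts setT p :\ set0 by rewrite in_setD1 U0.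
apply: (eq_row_sub (enum_rank_in U1 U)).
by rewrite rowK enum_rankK_in.
Qed.

(* The entry of [v *m cut_matrix] at a lowest point of the largest cut with a
   nonzero coefficient is that coefficient alone. *)
Lemma row_free_cut_matrix n (x : 'I_n -> R) :
  row_free (cut_matrix (pattern setT x)).
Proof.
apply: inj_row_free => v vB; apply/eqP; apply: contraT => /rV0Pn[k0 vk0].
case: (@fintype.arg_maxnP _ k0 (fun k => v ord0 k != 0)
   (fun k => #|enum_val k : {set 'I_n}|) vk0) => k vk kmax.
have := enum_valP k; rewrite in_setD1 => /andP[/set0Pn[i0 i0k] ck].
case: (@arg_minP _ _ _ i0 (mem (enum_val k : {set 'I_n})) x i0k) => i ik imin.
have {}ik : i \in enum_val k := ik; move/rowP/(_ i): vB; rewrite !mxE (bigD1 k) //= !mxE ik mulr1.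
rewrite big1 ?addr0 => [e|k' k'k]; first by rewrite e eqxx in vk.
rewrite !mxE; have [->|vk'] := eqVneq (v ord0 k') 0; first by rewrite mul0r.
case: (boolP (i \in _)) => [ik'|]; last by rewrite mulr0.
have := enum_valP k'; rewrite in_setD1 => /andP[_ ck'].
have kk' : enum_val k' != enum_val k by apply: contra k'k => /eqP/enum_val_inj ->.
(* A smaller cut through the lowest point [i] would miss some j of the larger one, and then x_j <
   x_i. A larger cut contradicts the choice of [k]. *)
case/orP: (cuts_chain ck ck') => sub; last first.
  have /subsetPn[j jk jk'] : ~~ (enum_val k \subset enum_val k').
    by apply: contra kk' => sub'; rewrite eqEsubset sub.
  case/cutsP: ck' => _ /(_ i j a0 ik' (in_setT _) jk').
  by have := imin j jk; have := A_gt0 a0 => *; exfalso; lra.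
case/negP: kk'; rewrite eq_sym eqEcard sub; exact: kmax.
Qed.

Lemma coord_le_eucl_dist n (x y : 'rV[R]_n) i :
  `|x ord0 i - y ord0 i| <= eucl_dist x y.
Proof.
rewrite -sqrtr_sqr ler_wsqrtr // (bigD1 i) //= lerDl.
by apply: sumr_ge0 => j _; exact: sqr_ge0.
Qed.

(** Differences within [U] or within its complement do not change. Those from [U] to the complement
    already exceed every a and do not decrease; the opposite ones are negative and do not
    increase. *)
Lemma region_shift n (p : {set 'I_n * 'I_n * A}) (x : 'rV[R]_n) U c :
  region p x -> U \in cuts setT p -> 0 <= c -> region p (x + c *: cut_indicator U).
Proof.
move=> [gx <-] /cutsP[_ cU] c0.
have E i j : (x + c *: cut_indicator U) ord0 i - (x + c *: cut_indicator U) ord0 j =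
   x ord0 i - x ord0 j + c * ((i \in U)%:R - (j \in U)%:R) by rewrite !mxE; ring.
have lt i j (a : A) :
    ((x + c *: cut_indicator U) ord0 i - (x + c *: cut_indicator U) ord0 j < val a) =
    (x ord0 i - x ord0 j < val a) /\
    (x + c *: cut_indicator U) ord0 i - (x + c *: cut_indicator U) ord0 j != val a.
  rewrite E; have := gx i j a (in_setT _) (in_setT _).
  case: (boolP (i \in U)) => iU; case: (boolP (j \in U)) => jU;
    rewrite ?subrr ?mulr0 ?addr0 //.
    have := cU i j a iU (in_setT _) jU; rewrite subr0 mulr1.
    move: (x ord0 i - x ord0 j) => u le ne.
    have lt : val a < u by rewrite lt_neqAle eq_sym ne.
    have ltc : val a < u + c by rewrite (lt_le_trans lt) // lerDl.
    by rewrite (lt_gtF lt) (lt_gtF ltc) gt_eqF.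
  have := cU j i a0 jU (in_setT _) iU; have := A_gt0 a0; have := A_gt0 a.
  rewrite sub0r mulrN1 /= => H H0 H1 _.
  have -> : x ord0 i - x ord0 j - c < fsval a by lra.
  have -> : x ord0 i - x ord0 j < fsval a by lra.
  by split=> //; rewrite lt_eqF //; lra.
split.
  by move=> i j a _ _; have [] := lt i j a.
by apply/setP => -[[i j] a]; rewrite !in_pattern !in_setT; have [] := lt i j a.
Qed.

(** The ray from [x] along a cut indicator stays in the region, hence near [W], which forces the
    indicator into [W]. Independence of the indicators then bounds the dimension. *)
Lemma near_subspace_ge n (p : {set 'I_n * 'I_n * A}) (x : 'rV[R]_n) k :
  region p x -> near_subspace_dim (region p) k -> (#|cuts setT p|.-1 <= k)%N.
Proof.
move=> px [W [r [<- [r0 nearW]]]].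
have indW U : U \in cuts setT p -> (cut_indicator U <= W)%MS.
  move=> cU; rewrite submxE; apply/eqP/rowP => j; rewrite [RHS]mxE.
  (* [W] is the kernel of [K], so subtracting a nearby point of [W] leaves the entry u + c v
     unchanged and bounds it independently of c. *)
  set K := cokermx W; set v := (X in X = 0); set u := (x *m K) ord0 j.
  have bound c : 0 <= c -> `|u + c * v| <= \sum_i r * `|K i j|.
    move=> c0; have [w wW dw] := nearW _ (region_shift px cU c0).
    have -> : u + c * v = ((x + c *: cut_indicator U - w) *m K) ord0 j.
      have /eqP wK : w *m K == 0 by rewrite -submxE.
      by rewrite mulmxBl mulmxDl -scalemxAl wK subr0 [RHS]mxE [X in _ = _ + X]mxE.
    rewrite mxE; apply: le_trans (ler_norm_sum _ _ _) _; apply: ler_sum => i _.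
    rewrite normrM ler_wpM2r //; apply: le_trans dw.
    have := coord_le_eucl_dist (x + c *: cut_indicator U) w i.
    by rewrite [X in _ -> `|X| <= _]mxE [X in _ -> `|_ + X| <= _]mxE.
  apply/eqP; apply: contraT => v0; have vp : 0 < `|v| by rewrite normr_gt0.
  set B := \sum_i _ in bound.
  have B0 : 0 <= B by have := bound 0 (lexx 0); exact: le_trans.
  (* This makes c |v| equal to B + |u| + 1, too large for |u + c v| <= B. *)
  pose c := (B + `|u| + 1) / `|v|.
  have c0 : 0 <= c by rewrite divr_ge0 // !addr_ge0.
  have := bound c c0; have := ler_normB (u + c * v) u.
  rewrite addrC addKr normrM (ger0_norm c0) /c divfK ?gt_eqF //.
  by move=> *; lra.
have -> : #|cuts setT p|.-1 = \rank (cut_matrix p).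
  case: px => _ <-; rewrite (eqP (row_free_cut_matrix _)).
  by rewrite (cardsD1 set0 (cuts _ _)) cuts0.
apply: mxrankS; apply/row_subP => k'; rewrite rowK; apply: indW.
by have := enum_valP k'; rewrite in_setD1 => /andP[].
Qed.

(** Pigeonhole: #|I| values cannot meet all of #|I| + 1 disjoint half-open intervals of length
    [M]. *)
Lemma empty_gap (I : finType) (y : I -> R) (b M : R) : 0 < M ->
  exists d : 'I_(#|I|.+1), forall j, y j <= b + M * d%:R \/ b + M * d.+1%:R < y j.
Proof.
move=> M0; apply: contrapT => nogap.
have H (d : 'I_(#|I|.+1)) : exists j, b + M * d%:R < y j <= b + M * d.+1%:R.
  apply: contrapT => nj; apply: nogap; exists d => j.
  have [|lt] := leP (y j) (b + M * d%:R); [by left|right].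
  by rewrite ltNge; apply/negP => le; apply: nj; exists j; rewrite lt.
have [f Hf] := choice H.
have inj : injective f.
  have lt_f d d' : f d = f d' -> (d' <= d)%N.
    move=> e; rewrite leqNgt; apply/negP => dd'.
    have /andP[_ h1] := Hf d; have /andP[h2 _] := Hf d'.
    have : (d.+1%:R : R) <= d'%:R by rewrite ler_nat.
    by move: h1 h2; rewrite e => h1 h2 h3; nra.
  by move=> d d' e; apply/val_inj/eqP; rewrite eqn_leq !lt_f.
by have := leq_card f inj; rewrite card_ord ltnn.
Qed.

(* Induction on T: a gap of length M above the minimum of y on T separates a
   smaller cut T' from coordinates that are all close to that minimum. *)
Lemma cut_approximation n (p : {set 'I_n * 'I_n * A}) (y : 'rV[R]_n) M T :
  0 < M -> (forall a : A, val a <= M) -> region p y -> T \in cuts setT p ->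
  exists w : 'rV[R]_n, [/\ (w <= cut_matrix p)%MS, forall i, i \notin T -> w ord0 i = 0
    & forall i, i \in T -> `|y ord0 i - w ord0 i| <= M * n.+1%:R].
Proof.
move=> M0 AM py; have [m] := ubnP #|T|; elim: m T => // m IH T Tm cT.
have [->|/set0Pn[k0 k0T]] := eqVneq T set0.
  by exists 0; split=> [|i _|i]; rewrite ?sub0mx ?mxE ?inE.
case: (@arg_minP _ _ _ k0 (mem T) (y ord0) k0T) => k kT kmin.
have {}kT : k \in T := kT.
have [d Hd] := @empty_gap _ (y ord0) (y ord0 k) M M0.
pose T' := [set j | y ord0 k + M * d.+1%:R < y ord0 j].
have kd : y ord0 k <= y ord0 k + M * d%:R by rewrite lerDl mulr_ge0 // ltW.
have dS : M * d.+1%:R = M * d%:R + M by rewrite -natr1 mulrDr mulr1.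
have [_ pE] := py.
have /cutsP[_ cTy] : T \in cuts setT (pattern setT (y ord0)) by rewrite pE.
have T'T : T' \subset T.
  apply/subsetP => j; rewrite inE => jd; apply: contraT => jT.
  by have := cTy k j a0 kT (in_setT _) jT; have := A_gt0 a0 => *; lra.
have kT' : k \notin T' by rewrite inE -leNgt; lra.
(* Values on [T'] lie above the gap and all others at or below its bottom, so they differ by more
   than [M], which bounds every a. *)
have cT' : T' \in cuts setT p.
  rewrite -pE; apply/cutsP; split; first exact: finset.subsetT.
  move=> i j a; rewrite !inE => id _; have := AM a.
  by case: (Hd j) => [jd aM _|-> //]; lra.
have [|w [wp w0 wy]] := IH T' _ cT'.
  rewrite -ltnS; apply: leq_trans Tm; rewrite ltnS; apply: proper_card.
  by rewrite properE T'T; apply/subsetPn; exists k.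
(* On [T] outside [T'] the constant y_k is a good approximation: the values there exceed it by at
   most M (d + 1), and d <= n. *)
exists (w + y ord0 k *: (cut_indicator T - cut_indicator T')); split.
- apply: addmx_sub => //; apply: scalemx_sub; apply: addmx_sub.
    exact: cut_indicator_sub.
  by rewrite eqmx_opp cut_indicator_sub.
- move=> i iT; have iT' : i \notin T' by apply: contra iT; exact: subsetP.
  by rewrite !mxE (negPf iT) (negPf iT') subrr mulr0 addr0 w0.
- move=> i iT; rewrite !mxE iT; case: (boolP (i \in T')) => iT'.
    by rewrite subrr mulr0 addr0 wy.
  rewrite w0 // subr0 mulr1 add0r ger0_norm ?subr_ge0 ?kmin //.
  have : y ord0 i <= y ord0 k + M * d.+1%:R by move: iT'; rewrite inE -leNgt.
  rewrite -lerBlDl => /le_trans; apply; rewrite ler_pM2l // ler_nat.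
  by rewrite -[X in (_ <= X.+1)%N]card_ord.
Qed.

Lemma near_subspace_cuts n (p : {set 'I_n * 'I_n * A}) (x : 'rV[R]_n) :
  region p x -> near_subspace_dim (region p) #|cuts setT p|.-1.
Proof.
move=> px; have [M HM] := @finite_upper_bound A val.
have M0 : 0 < M := lt_trans (A_gt0 a0) (HM a0).
pose r := Num.sqrt (\sum_(i < n) (M * n.+1%:R) ^+ 2).
(* [<<_>>] gives a square matrix with the same row space; adding 1 keeps the radius positive even
   for n = 0. *)
exists <<cut_matrix p>>%MS, (1 + r); split.
  rewrite genmxE; case: px => _ <-; rewrite (eqP (row_free_cut_matrix _)).
  by rewrite (cardsD1 set0 (cuts _ _)) cuts0.
split=> [|y py]; first by rewrite ltr_pwDl ?sqrtr_ge0.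
have [||w [wp _ wy]] := @cut_approximation _ p y M setT M0 _ py.
- by move=> a; exact/ltW.
- by case: px => _ <-; exact: cutsT.
exists w; first by rewrite genmxE.
apply: (@le_trans _ _ r); last by rewrite lerDr.
apply: ler_wsqrtr; apply: ler_sum => i _.
rewrite -real_normK ?num_real // ler_sqr ?nnegrE ?mulr_ge0 ?(ltW M0) //.
exact: wy.
Qed.

Lemma has_level_region n (p : {set 'I_n * 'I_n * A}) (x : 'rV[R]_n) l :
  region p x -> has_level (region p) l <-> #|cuts setT p| = l.+1.
Proof.
move=> px; have c0 : (0 < #|cuts setT p|)%N by case: px => _ <-; exact: card_cuts_gt0.
have near := near_subspace_cuts px; split=> [[nl lmin]|e].
  apply/eqP; rewrite -(prednK c0) eqSS eqn_leq (near_subspace_ge px nl) /=.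
  by rewrite leqNgt; apply/negP => /lmin.
split; first by move: near; rewrite e.
by move=> k kl /(near_subspace_ge px); rewrite e /= leqNgt kl.
Qed.

(** * Counting regions and exponential generating functions *)

Lemma r_level_pattern_count l n : r_level A l n = pattern_count l n.
Proof.
rewrite /r_level /pattern_count.
have -> : [set S | semiorder_regions A n S /\ has_level S l]%classic =
          [set` [fset region p | p in patterns [set: 'I_n] l]%fset]%classic.
  apply/seteqP; split=> [S [[x /semiorder_complementE gx ->]]|S /imfsetP[p /= pl ->]].
    rewrite component_region // => /(has_level_region l (conj gx erefl)) cl.
    apply/imfsetP; exists (pattern setT (x ord0)) => //=.
    by apply/patternsP; exists (x ord0).
  case/patternsP: pl => x [gx -> cl].
  have xE : (\row_i x i : 'rV[R]_n) ord0 = x by apply/funext => i; rewrite mxE.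
  have px : region (pattern setT x) (\row_i x i) by rewrite /region /= xE.
  split; last by apply/(has_level_region l px).
  exists (\row_i x i); first by apply/semiorder_complementE; rewrite xE.
  by rewrite component_region xE.
rewrite set_fsetK card_in_imfset /=; first by rewrite cardE.
(* The region of a realised pattern is nonempty and any point of it returns the pattern, so distinct
   patterns have distinct regions. *)
move=> p q /patternsP[x [gx -> _]] _ e.
have : region (pattern setT x) (\row_i x i).
  by have xE : (\row_i x i : 'rV[R]_n) ord0 = x by [apply/funext => i; rewrite mxE];
     rewrite /region /= xE.
by rewrite e => -[_ <-]; congr pattern; apply/funext => i; rewrite mxE.
Qed.

Lemma F_starS l : F_star A l.+1 = fps_mul (F_star A 1) (F_star A l).
Proof.
apply/funext => n; rewrite /F_star /fps_mul r_level_pattern_count pattern_countS //.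
rewrite natr_sum mulr_suml; apply: eq_bigr => k _.
rewrite !r_level_pattern_count !natrM.
have kn : (k <= n)%N by rewrite -ltnS.
(* Writing n! as 'C(n, k) k! (n - k)! turns the binomial recurrence into a product of series. *)
have := congr1 (fun m => m%:R : rat) (bin_fact kn); rewrite !natrM => <-.
have f0 m : (m`!%:R : rat) != 0 by rewrite pnatr_eq0 -lt0n fact_gt0.
have b0 : ('C(n, k)%:R : rat) != 0 by rewrite pnatr_eq0 -lt0n bin_gt0.
by field; rewrite !f0 b0.
Qed.

Lemma F_star0 : F_star A 0 = @fps_one rat.
Proof.
apply/funext => n; rewrite /F_star r_level_pattern_count pattern_count0 /fps_one.
by case: n => [|n] /=; rewrite ?mul0r // fact0 divr1.
Qed.

End Patterns.

Theorem theorem1p3 (R : realType) (A : {fset R}) (l : nat) :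
  A != fset0 -> (forall a, a \in A -> 0 < a) ->
  F_star A l = fps_exp (F_star A 1) l.
Proof.
move=> /fset0Pn[b bA] A_gt0.
have A_pos (a : A) : 0 < val a by apply: A_gt0; exact: fsvalP.
elim: l => [|l IHl]; first exact: F_star0 A_pos [` bA]%fset.
by rewrite (F_starS A_pos [` bA]%fset) IHl.
Qed.
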